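(* $\mathbb{R}$ (the set of minimal rational Cauchy filters) with addition and multiplication is a field.
   Context: For $q\in\mathbb{Q}$ and rational $\varepsilon>0$ let $q_\varepsilon=\{x\in\mathbb{Q}\mid q-\varepsilon<x<q+\varepsilon\}$. A (rational) filter is a non-empty collection $\mathcal{F}$ of subsets of $\mathbb{Q}$ closed under binary intersections and under supersets (in $\mathbb{Q}$); the improper filter $\mathcal{P}(\mathbb{Q})$ is allowed as a filter. A filter $\mathcal{F}$ is Cauchy if for every rational $\varepsilon>0$ there is $q\in\mathbb{Q}$ with $q_\varepsilon\in\mathcal{F}$. A minimal Cauchy filter is a Cauchy filter $\mathcal{F}$ such that any Cauchy filter $\mathcal{G}\subseteq\mathcal{F}$ satisfies $\mathcal{G}=\mathcal{F}$. In this statement $\mathbb{R}$ denotes the set of all minimal Cauchy filters in $\mathbb{Q}$, and its elements are called real numbers. For $A,B\subseteq\mathbb{Q}$ let $A+B=\{\alpha+\beta\mid\alpha\in A,\beta\in B\}$ and $AB=\{\alpha\beta\mid\alpha\in A,\beta\in B\}$. For real numbers $a,b$, the sum $a+b$ is the collection of all $C\subseteq\mathbb{Q}$ such that $C\supseteq A+B$ for some $A\in a$, $B\in b$; the product $ab$ is the collection of all $C\subseteq\mathbb{Q}$ such that $C\supseteq AB$ for some $A\in a$, $B\in b$. These are regarded as binary operations on $\mathbb{R}$. *)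

(* Defs.v *)
From HB Require Import structures.
From mathcomp Require Import all_boot all_order all_algebra.
From mathcomp Require Import boolp classical_sets filter.
Set Implicit Arguments.
Unset Strict Implicit.
Unset Printing Implicit Defensive.
Import Order.TTheory GRing.Theory Num.Theory.
Local Open Scope classical_set_scope.
Local Open Scope ring_scope.

Definition rball (q e : rat) : set rat := [set x : rat | q - e < x < q + e].

(* [Filter] does not require properness: the improper filter [setT] is
   allowed.  Its field [filterT] is equivalent to non-emptiness, by [filterS]. *)
Definition cauchy_filter (F : set_system rat) : Prop :=
  Filter F /\ forall e : rat, 0 < e -> exists q : rat, F (rball q e).

Definition minimal_cauchy_filter (F : set_system rat) : Prop :=
  cauchy_filter F /\
  forall G : set_system rat, cauchy_filter G -> G `<=` F -> G = F.

Definition cauchy_real : Type := set_type [set F | minimal_cauchy_filter F].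

Definition filter_of (a : cauchy_real) : set_system rat := val a.

Definition filter_add (F G : set_system rat) : set_system rat :=
  [set C : set rat | exists A B : set rat,
     [/\ F A, G B & [set x + y | x in A & y in B] `<=` C]].

Definition filter_mul (F G : set_system rat) : set_system rat :=
  [set C : set rat | exists A B : set rat,
     [/\ F A, G B & [set x * y | x in A & y in B] `<=` C]].

(* Main.v *)
(* A proper Cauchy filter [F] contains exactly one minimal Cauchy filter, the
   filter [roundification F] generated by the uniform thickenings of its
   members; so [F] is itself minimal iff each member of [F] contains a uniform
   thickening of another one, and two minimal Cauchy filters contained in a
   common proper filter are equal.  Each field axiom thus reduces to inclusions
   of filters, and opposites and inverses may be taken as roundifications of
   image filters.  Roundness of a product [F G] with [F] away from 0 holds since
   [z = x * (z / x)] with [z / x] close to [y] as soon as [z] is close to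
   [x * y]; when [F] is the filter of 0, [F G] is directly found to be [F]. *)
Require Import Defs.
From HB Require Import structures.
From mathcomp Require Import all_boot all_order all_algebra.
From mathcomp Require Import ring lra.
From mathcomp Require Import boolp classical_sets filter.
Import Order.TTheory GRing.Theory Num.Theory.
Local Open Scope classical_set_scope.
Local Open Scope ring_scope.

(* [lra] does not interpret norms, so the bounds [`|x| < e] are unfolded. *)
Local Ltac norm_lra :=
  repeat match goal with H : is_true (`|_| < _) |- _ =>
    rewrite ltr_norml in H; case/andP: H => ? ? end;
  rewrite ?ltr_norml; lra.

(** * Binary operations lifted to filters *)

Section FilterLift.
Context {T U V : Type}.
Implicit Types (F : set_system T) (G : set_system U).

(* Convertible to [filter_add] and [filter_mul] for [op] the sum and product. *)
Definition filter_lift2 (op : T -> U -> V) F G : set_system V :=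
  [set C | exists A B, [/\ F A, G B & [set op x y | x in A & y in B] `<=` C]].

Lemma filter_lift2_filter op F G :
  Filter F -> Filter G -> Filter (filter_lift2 op F G).
Proof.
move=> FF FG; split.
- by exists setT, setT; split=> //; exact: filterT.
- move=> P Q [A [B [FA GB sP]]] [A' [B' [FA' GB' sQ]]].
  exists (A `&` A'), (B `&` B'); split; [exact: filterI..|].
  move=> _ [x [Ax A'x] [y [By B'y] <-]]; split.
    by apply: sP; exists x => //; exists y.
  by apply: sQ; exists x => //; exists y.
- move=> P Q PQ [A [B [FA GB sP]]]; exists A, B; split=> //.
  exact: subset_trans sP PQ.
Qed.

Lemma filter_lift2_proper op F G :
  ProperFilter F -> ProperFilter G -> ProperFilter (filter_lift2 op F G).
Proof.
move=> FF FG; split; last exact: filter_lift2_filter.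
move=> [A [B [FA GB s0]]].
have [x Ax] := @filter_ex _ _ FF _ FA.
have [y By] := @filter_ex _ _ FG _ GB.
by apply: (s0 (op x y)); exists x => //; exists y.
Qed.

Lemma filter_lift2_mono op F F' G G' : F `<=` F' -> G `<=` G' ->
  filter_lift2 op F G `<=` filter_lift2 op F' G'.
Proof.
move=> sF sG C [A [B [FA GB sC]]]; exists A, B.
by split=> //; [exact: sF|exact: sG].
Qed.

End FilterLift.

Section FilterLiftLaws.
Context {T : Type}.
Implicit Types F G H : set_system T.

Lemma filter_lift2C (op : T -> T -> T) F G :
  commutative op -> filter_lift2 op F G = filter_lift2 op G F.
Proof.
move=> opC; suff sub K L : filter_lift2 op K L `<=` filter_lift2 op L K.
  by apply/seteqP; split; exact: sub.
move=> C [A [B [KA LB sC]]]; exists B, A; split=> //.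
by move=> _ [y By [x Ax <-]]; rewrite opC; apply: sC; exists x => //; exists y.
Qed.

Lemma filter_lift2A (op : T -> T -> T) F G H : associative op ->
  filter_lift2 op F (filter_lift2 op G H) =
  filter_lift2 op (filter_lift2 op F G) H.
Proof.
move=> opA; apply/seteqP; split=> D.
- move=> [A [E [FA [B [C [GB HC sE]]] sD]]].
  exists [set op x y | x in A & y in B], C; split=> //; first by exists A, B; split.
  move=> _ [_ [x Ax [y By <-]] [z Cz <-]]; rewrite -opA; apply: sD.
  exists x => //; exists (op y z) => //; apply: sE.
  by exists y => //; exists z.
- move=> [E [C [[A [B [FA GB sE]]] HC sD]]].
  exists A, [set op y z | y in B & z in C]; split=> //; first by exists B, C; split.
  move=> _ [x Ax [_ [y By [z Cz <-]] <-]]; rewrite opA; apply: sD.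
  exists (op x y); first by apply: sE; exists x => //; exists y.
  by exists z.
Qed.

End FilterLiftLaws.

(** * Cauchy filters through small and bounded members *)

Lemma rballE q e x : rball q e x <-> `|x - q| < e.
Proof. by rewrite /rball /= ltr_distl. Qed.

(** Properness makes a small member inhabited, and any of its points can serve as the centre of a
    ball. *)
Lemma cauchy_filterP {F : set_system rat} : ProperFilter F ->
  cauchy_filter F <->
  forall e, 0 < e ->
    exists2 A, F A & forall x y, A x -> A y -> `|x - y| < e.
Proof.
move=> FF; split.
- move=> [_ cF] e e0; have [|q Fq] := cF (e / 2); first lra.
  exists (rball q (e / 2)) => // x y /rballE qx /rballE qy; norm_lra.
- move=> cF; split=> [|e /cF[A FA sA]]; first exact: filter_filter.
  have [q Aq] := filter_ex FA.
  by exists q; apply: filterS FA => x Ax; apply/rballE/sA.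
Qed.

Lemma cauchy_filter_bounded {F : set_system rat} : cauchy_filter F ->
  exists2 M, 0 < M & F [set x | `|x| < M].
Proof.
move=> [FF cF]; have [|q Fq] := cF 1; first lra.
exists (`|q| + 1); first by have := normr_ge0 q; lra.
apply: filterS Fq => x /rballE /= qx.
by rewrite -(subrK q x) addrC (le_lt_trans (ler_normD _ _))// ltrD2l.
Qed.

(** * Round filters and minimality *)

Definition roundification (F : set_system rat) : set_system rat :=
  [set C | exists2 A, F A &
     exists2 e, 0 < e & forall x y, A x -> `|y - x| < e -> C y].

Lemma roundification_sub {F} : Filter F -> roundification F `<=` F.
Proof.
move=> FF C [A FA [e e0 sC]]; apply: filterS FA => x Ax.
by apply: (sC x) => //; rewrite subrr normr0.
Qed.

Lemma roundification_filter {F} : Filter F -> Filter (roundification F).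
Proof.
move=> FF; split.
- by exists setT; [exact: filterT|exists 1].
- move=> P Q [A FA [e e0 sP]] [B FB [f f0 sQ]].
  exists (A `&` B); first exact: filterI.
  exists (Num.min e f); first by rewrite lt_min e0.
  move=> x y [Ax Bx]; rewrite lt_min => /andP[xye xyf].
  by split; [exact: sP xye|exact: sQ xyf].
- move=> P Q PQ [A FA [e e0 sP]]; exists A => //; exists e => // x y Ax xy.
  exact/PQ/(sP x).
Qed.

Lemma roundification_cauchy {F} : cauchy_filter F ->
  cauchy_filter (roundification F).
Proof.
move=> [FF cF]; split=> [|e e0]; first exact: roundification_filter.
have [|q Fq] := cF (e / 2); first lra.
exists q, (rball q (e / 2)) => //; exists (e / 2); first lra.
move=> x y /rballE qx xy; apply/rballE; norm_lra.
Qed.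

(** A Cauchy [G] inside [F] has a ball of radius [e / 2], which meets [A] because [F] is proper; the
    [e]-thickening of [A] then covers the whole ball, so [C] is in [G]. *)
Lemma sub_roundification_minimal F : ProperFilter F -> cauchy_filter F ->
  F `<=` roundification F -> minimal_cauchy_filter F.
Proof.
move=> PF cF rF; split=> // G [GG cG] GF; apply/seteqP; split=> // C FC.
have [A FA [e e0 sC]] := rF _ FC.
have [|q Gq] := cG (e / 2); first lra.
have [x [Ax /rballE qx]] := filter_ex (filterI FA (GF _ Gq)).
by apply: filterS Gq => y /rballE qy; apply: sC Ax _; norm_lra.
Qed.

Lemma roundification_proper {F} : ProperFilter F ->
  ProperFilter (roundification F).
Proof.
move=> PF; split; last exact: roundification_filter.
by move=> /roundification_sub; exact: filter_not_empty.
Qed.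

(** Thickening twice by [e / 2] stays within thickening once by [e], so a roundification is itself
    round. *)
Lemma roundification_minimal {F} : ProperFilter F -> cauchy_filter F ->
  minimal_cauchy_filter (roundification F).
Proof.
move=> PF cF; apply: sub_roundification_minimal.
- exact: roundification_proper.
- exact: roundification_cauchy.
move=> C [A FA [e e0 sC]].
exists [set y | exists2 x, A x & `|y - x| < e / 2].
  exists A => //; exists (e / 2); first lra.
  by move=> x y Ax xy; exists x.
exists (e / 2); first lra.
by move=> y z [x Ax xy] yz; apply: sC Ax _; norm_lra.
Qed.

(** This is the neighbourhood filter of [q] in the rationals, that is, [q] seen as a real number. *)
Definition rat_filter (q : rat) : set_system rat :=
  roundification (principal_filter q).

Lemma rat_filter_ball q e : 0 < e -> rat_filter q [set x | `|x - q| < e].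
Proof.
move=> e0; exists [set q]; first exact/principal_filterP.
by exists e => // x y ->.
Qed.

Lemma rat_filter_subP {q H} : Filter H ->
  (forall e, 0 < e -> H [set x | `|x - q| < e]) -> rat_filter q `<=` H.
Proof.
move=> FH Hq C [A /principal_filterP Aq [e e0 sC]].
by apply: filterS (Hq e e0) => y qy; exact: sC Aq qy.
Qed.

Lemma rat_filter_proper q : ProperFilter (rat_filter q).
Proof. by apply: roundification_proper; exact: principal_filter_proper. Qed.

Lemma rat_filter_minimal q : minimal_cauchy_filter (rat_filter q).
Proof.
have PF := principal_filter_proper q; apply: roundification_minimal => //.
apply/cauchy_filterP => e e0; exists [set q]; first exact/principal_filterP.
by move=> x y -> ->; rewrite subrr normr0.
Qed.

(** * Properties of minimal Cauchy filters *)

Section MinimalCauchyFilter.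
Context {F : set_system rat} (mF : minimal_cauchy_filter F).

(** The improper filter contains the proper Cauchy filter [rat_filter 0], hence is not minimal. *)
Lemma minimal_cauchy_filter_proper : ProperFilter F.
Proof.
have [[FF cF] minF] := mF; split=> // F0.
have F_all : rat_filter 0 `<=` F by move=> C _; exact: filterS F0.
have [cauchy0 _] := rat_filter_minimal 0.
move: F0; rewrite -(minF _ cauchy0 F_all).
exact: (@filter_not_empty _ _ (rat_filter_proper 0)).
Qed.

Lemma minimal_cauchy_filter_round : F `<=` roundification F.
Proof.
have [cF minF] := mF; have [FF _] := cF.
by rewrite (minF _ (roundification_cauchy cF) (roundification_sub FF)).
Qed.

(** By contraposition: if no member stays away from 0, a ball of radius [e / 3] in [F] has a point
    of absolute value below [e / 3], so it lies within [e] of 0. Thus [F] contains [rat_filter 0],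
    and minimality gives equality. *)
Lemma minimal_cauchy_filter_away0 : F <> rat_filter 0 ->
  exists2 d, 0 < d & F [set x | d <= `|x|].
Proof.
have [[FF cF] minF] := mF; apply: contra_notP => nF.
have [cauchy0 _] := rat_filter_minimal 0; apply/esym/minF => //.
apply: rat_filter_subP => e e0; have [|q Fq] := cF (e / 3); first lra.
have [[x [/rballE qx x0]]|nq] :=
    pselect (exists x, rball q (e / 3) x /\ `|x| < e / 3).
  by apply: filterS Fq => y /rballE qy /=; norm_lra.
exfalso; apply: nF; exists (e / 3); first lra.
apply: filterS Fq => x qx /=; rewrite leNgt; apply/negP => x0.
by apply: nq; exists x.
Qed.

End MinimalCauchyFilter.

(** Balls of radius [e / 3] from [F] and [G] meet, both being in the proper [H], so a single ball of
    radius [e] contains them. Hence the intersection of [F] and [G] is Cauchy, and minimality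
    equates it with each. *)
Lemma minimal_cauchy_filter_eq {F G H : set_system rat} : ProperFilter H ->
  minimal_cauchy_filter F -> minimal_cauchy_filter G ->
  F `<=` H -> G `<=` H -> F = G.
Proof.
move=> PH [[FF cF] mF] [[FG cG] mG] FH GH.
have cFG : cauchy_filter (F `&` G).
  split=> [|e e0].
    split; first by split; exact: filterT.
    - by move=> P Q [FP GP] [FQ GQ]; split; exact: filterI.
    - by move=> P Q PQ [FP GP]; split; [apply: filterS FP|apply: filterS GP].
  have [|q Fq] := cF (e / 3); first lra.
  have [|r Gr] := cG (e / 3); first lra.
  have [x [/rballE qx /rballE rx]] := filter_ex (filterI (FH _ Fq) (GH _ Gr)).
  exists q; split.
    by apply: filterS Fq => y /rballE qy; apply/rballE; norm_lra.
  by apply: filterS Gr => y /rballE ry; apply/rballE; norm_lra.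
by rewrite -(mF _ cFG (@subIsetl _ _ _)) -{2}(mG _ cFG (@subIsetr _ _ _)).
Qed.

(** * Sums and products of minimal Cauchy filters *)

Lemma filter_add_minimal {F G} :
  minimal_cauchy_filter F -> minimal_cauchy_filter G ->
  minimal_cauchy_filter (filter_add F G).
Proof.
move=> mF mG.
have PF := minimal_cauchy_filter_proper mF.
have PG := minimal_cauchy_filter_proper mG.
have PH : ProperFilter (filter_add F G) by exact: filter_lift2_proper.
apply: sub_roundification_minimal => //.
  apply/cauchy_filterP => e e0; have e20 : 0 < e / 2 by lra.
  have [A FA sA] := (cauchy_filterP PF).1 mF.1 _ e20.
  have [B GB sB] := (cauchy_filterP PG).1 mG.1 _ e20.
  exists [set x + y | x in A & y in B]; first by exists A, B; split.
  move=> _ _ [x Ax [y By <-]] [x' Ax' [y' By' <-]].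
  by have := sA x x' Ax Ax'; have := sB y y' By By'; norm_lra.
move=> C [A [B [FA GB sC]]].
(* Thickening one summand suffices: a point [z] near [x + y] is [(z - y) + y] with [z - y] near
   [x]. *)
have [A' FA' [e e0 sA]] := minimal_cauchy_filter_round mF _ FA.
exists [set x + y | x in A' & y in B]; first by exists A', B; split.
exists e => // _ z [x A'x [y By <-]] xyz; apply: sC.
exists (z - y); last by exists y => //; ring.
by apply: (sA x) => //; rewrite addrAC -addrA -opprD.
Qed.

Lemma filter_mul_cauchy {F G} : ProperFilter F -> ProperFilter G ->
  cauchy_filter F -> cauchy_filter G -> cauchy_filter (filter_mul F G).
Proof.
move=> PF PG cF cG.
have PH : ProperFilter (filter_mul F G) by exact: filter_lift2_proper.
apply/cauchy_filterP => e e0.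
have [M M0 FM] := cauchy_filter_bounded cF.
have [N N0 GN] := cauchy_filter_bounded cG.
(* These tolerances keep each term of [x * (y - y') + (x - x') * y'] below [e / 2]. *)
have eN0 : 0 < e / 2 / N by rewrite !divr_gt0.
have eM0 : 0 < e / 2 / M by rewrite !divr_gt0.
have [A FA sA] := (cauchy_filterP PF).1 cF _ eN0.
have [B GB sB] := (cauchy_filterP PG).1 cG _ eM0.
exists [set x * y | x in A `&` [set x | `|x| < M] & y in B `&` [set y | `|y| < N]].
  by exists (A `&` [set x | `|x| < M]), (B `&` [set y | `|y| < N]);
    split=> //; exact: filterI.
move=> _ _ [x [Ax Mx] [y [By Ny] <-]] [x' [Ax' Mx'] [y' [By' Ny'] <-]].
have -> : x * y - x' * y' = x * (y - y') + (x - x') * y' by ring.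
rewrite (splitr e) (le_lt_trans (ler_normD _ _))// ltrD// normrM.
  by rewrite -[ltRHS](divfK (lt0r_neq0 M0)) mulrC ltr_pM//; exact: sB.
by rewrite -[ltRHS](divfK (lt0r_neq0 N0)) ltr_pM//; exact: sA.
Qed.

(** By minimality of [rat_filter 0] only one inclusion is needed: a neighbourhood of 0 scaled by a
    nonzero [y] is again one. Roundness of [G] provides such a [y] in each member. *)
Lemma filter_mul_rat_filter0 {G} : minimal_cauchy_filter G ->
  filter_mul (rat_filter 0) G = rat_filter 0.
Proof.
move=> mG.
have P0 := rat_filter_proper 0; have [c0 _] := rat_filter_minimal 0.
have PG := minimal_cauchy_filter_proper mG.
apply: (rat_filter_minimal 0).2.
  by apply: filter_mul_cauchy => //; exact: mG.1.
move=> C [A [B [[A' A'0 [e e0 sA]] GB sC]]].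
have [y By y0] : exists2 y, B y & y != 0.
  have [B' GB' [f f0 sB]] := minimal_cauchy_filter_round mG _ GB.
  have [y B'y] := filter_ex GB'; have [y0|y0] := eqVneq y 0.
    exists (f / 2); last by rewrite gt_eqF// divr_gt0.
    by apply: sB B'y _; rewrite y0; norm_lra.
  by exists y => //; apply: sB B'y _; rewrite subrr normr0.
exists [set 0]; first exact/principal_filterP.
exists (e * `|y|); first by rewrite mulr_gt0// normr_gt0.
move=> _ z -> ze; apply: sC; exists (z / y); last by exists y; rewrite ?divfK.
apply: (sA 0); first exact/principal_filterP.
by rewrite !subr0 in ze *; rewrite normrM normfV ltr_pdivrMr// normr_gt0.
Qed.

Lemma filter_mul_minimal {F G} :
  minimal_cauchy_filter F -> minimal_cauchy_filter G ->
  minimal_cauchy_filter (filter_mul F G).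
Proof.
move=> mF mG; have [->|F0] := pselect (F = rat_filter 0).
  by rewrite filter_mul_rat_filter0//; exact: rat_filter_minimal.
have PF := minimal_cauchy_filter_proper mF.
have PG := minimal_cauchy_filter_proper mG.
have PH : ProperFilter (filter_mul F G) by exact: filter_lift2_proper.
apply: sub_roundification_minimal => //.
  by apply: filter_mul_cauchy => //; [exact: mF.1|exact: mG.1].
move=> C [A [B [FA GB sC]]].
have [d d0 Fd] := minimal_cauchy_filter_away0 mF F0.
have [B' GB' [e e0 sB]] := minimal_cauchy_filter_round mG _ GB.
exists [set x * y | x in A `&` [set x | d <= `|x|] & y in B'].
  by exists (A `&` [set x | d <= `|x|]), B'; split=> //; exact: filterI.
(* Dividing by [x] with [d <= |x|] turns the distance [d * e] into at most [e]. *)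
exists (d * e); first exact: mulr_gt0.
move=> _ z [x [Ax /= dx] [y B'y <-]] xyz.
have x_gt0 : 0 < `|x| by exact: lt_le_trans dx.
have x0 : x != 0 by rewrite -normr_gt0.
apply: sC; exists x => //; exists (z / x); last by rewrite mulrC divfK.
apply: (sB y) => //; rewrite -(ltr_pM2l x_gt0) -normrM.
have -> : x * (z / x - y) = z - x * y by field.
by apply: (lt_le_trans xyz); rewrite ler_pM2r.
Qed.

(** * Images under opposite and inverse *)

Lemma cauchy_opp F : ProperFilter F -> cauchy_filter F ->
  cauchy_filter (-%R @ F).
Proof.
move=> PF cF; apply/cauchy_filterP => e e0.
have [A FA sA] := (cauchy_filterP PF).1 cF _ e0.
exists [set x | A (- x)].
  by rewrite /fmap /=; apply: filterS FA => x Ax /=; rewrite opprK.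
by move=> x y Ax Ay; have := sA _ _ Ax Ay; norm_lra.
Qed.

Lemma cauchy_inv F d : ProperFilter F -> cauchy_filter F ->
  0 < d -> F [set x | d <= `|x|] -> cauchy_filter (GRing.inv @ F).
Proof.
move=> PF cF d0 Fd; apply/cauchy_filterP => e e0.
(* The difference of the inverses of [u] and [v] is [(v - u) / (u * v)], where [u * v] has absolute
   value at least [d * d]. *)
have [|A FA sA] := (cauchy_filterP PF).1 cF (e * (d * d)).
  by rewrite !mulr_gt0.
exists [set x | A (x^-1) /\ d <= `|x^-1|].
  rewrite /fmap /=; apply: filterS (filterI FA Fd) => x [Ax dx] /=.
  by rewrite invrK.
move=> x y [Ax dx] [Ay dy].
have x0 : x^-1 != 0 by rewrite -normr_gt0 (lt_le_trans d0).
have y0 : y^-1 != 0 by rewrite -normr_gt0 (lt_le_trans d0).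
have xy_gt0 : 0 < `|x^-1 * y^-1| by rewrite normr_gt0 mulf_neq0.
rewrite -(ltr_pM2r xy_gt0) -normrM.
have -> : (x - y) * (x^-1 * y^-1) = y^-1 - x^-1.
  by rewrite invr_eq0 in x0; rewrite invr_eq0 in y0; field; rewrite x0.
apply: (lt_le_trans (sA _ _ Ay Ax)); rewrite ler_pM2l// normrM.
by apply: ler_pM => //; exact: ltW.
Qed.

(** * Real numbers and their operations *)

HB.instance Definition _ := gen_eqMixin cauchy_real.
HB.instance Definition _ := gen_choiceMixin cauchy_real.

Implicit Types a b : cauchy_real.

Definition real_of_filter {F} (mF : minimal_cauchy_filter F) : cauchy_real :=
  exist _ F (mem_set mF).

Lemma filter_of_minimal a : minimal_cauchy_filter (filter_of a).
Proof. exact: set_valP. Qed.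

Lemma filter_of_inj : injective filter_of.
Proof. exact: val_inj. Qed.

Lemma filter_of_proper a : ProperFilter (filter_of a).
Proof. exact/minimal_cauchy_filter_proper/filter_of_minimal. Qed.

Lemma filter_of_cauchy a : cauchy_filter (filter_of a).
Proof. by have [] := filter_of_minimal a. Qed.

#[local] Existing Instance filter_of_proper.
#[local] Hint Resolve filter_of_minimal filter_of_cauchy : core.

Definition creal_rat (q : rat) := real_of_filter (rat_filter_minimal q).

Definition creal_add a b :=
  real_of_filter (filter_add_minimal (filter_of_minimal a) (filter_of_minimal b)).

Definition creal_mul a b :=
  real_of_filter (filter_mul_minimal (filter_of_minimal a) (filter_of_minimal b)).

Lemma opp_minimal a : minimal_cauchy_filter (roundification (-%R @ filter_of a)).
Proof.
apply: roundification_minimal.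
exact: cauchy_opp.
Qed.

Definition creal_opp a := real_of_filter (opp_minimal a).

Lemma inv_minimal {a} : a <> creal_rat 0 ->
  minimal_cauchy_filter (roundification (GRing.inv @ filter_of a)).
Proof.
move=> a0; have [|d d0 ad] := minimal_cauchy_filter_away0 (filter_of_minimal a).
  by move=> /(@filter_of_inj a (creal_rat 0)).
apply: roundification_minimal.
exact: cauchy_inv d0 ad.
Qed.

(** The case split supplies the proof of [a <> creal_rat 0] that [inv_minimal] requires; the value
    at zero follows the library convention for fields. *)
Definition creal_inv a :=
  if pselect (a = creal_rat 0) is right a0 then real_of_filter (inv_minimal a0)
  else creal_rat 0.

(** * The field axioms *)

Lemma creal_addA : associative creal_add.
Proof.
move=> a b c; apply: filter_of_inj.
exact: (filter_lift2A _ _ _ _ (@addrA rat)).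
Qed.

Lemma creal_addC : commutative creal_add.
Proof.
by move=> a b; apply: filter_of_inj; exact: (filter_lift2C _ _ _ (@addrC rat)).
Qed.

(** Minimality of [a] leaves only the inclusion of the sum in [a], which holds because 0 lies in
    every member of [rat_filter 0]. *)
Lemma creal_add0 : left_id (creal_rat 0) creal_add.
Proof.
move=> a; apply: filter_of_inj; apply: (filter_of_minimal a).2 => //.
move=> C [A [B [/roundification_sub/principal_filterP A0 aB sC]]].
by apply: filterS aB => x Bx; apply: sC; exists 0 => //; exists x; rewrite ?add0r.
Qed.

Lemma creal_addN : left_inverse (creal_rat 0) creal_opp creal_add.
Proof.
move=> a; apply: filter_of_inj.
(* The sum formed with the image before roundification is a proper filter containing both sides. *)
have PH : ProperFilter (filter_add (-%R @ filter_of a) (filter_of a)).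
  exact: filter_lift2_proper.
apply: (minimal_cauchy_filter_eq PH) => //.
  by apply: filter_lift2_mono => //; exact: roundification_sub.
apply: rat_filter_subP => e e0.
have [A FA sA] := (cauchy_filterP (filter_of_proper a)).1 (filter_of_cauchy a) _ e0.
exists [set x | A (- x)], A; split=> //.
  by rewrite /fmap /=; apply: filterS FA => x Ax /=; rewrite opprK.
by move=> _ [x Ax [y Ay <-]] /=; have := sA _ _ Ax Ay; norm_lra.
Qed.

Lemma creal_mulA : associative creal_mul.
Proof.
move=> a b c; apply: filter_of_inj.
exact: (filter_lift2A _ _ _ _ (@mulrA rat)).
Qed.

Lemma creal_mulC : commutative creal_mul.
Proof.
by move=> a b; apply: filter_of_inj; exact: (filter_lift2C _ _ _ (@mulrC rat)).
Qed.

Lemma creal_mul1 : left_id (creal_rat 1) creal_mul.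
Proof.
move=> a; apply: filter_of_inj; apply: (filter_of_minimal a).2 => //.
move=> C [A [B [/roundification_sub/principal_filterP A1 aB sC]]].
by apply: filterS aB => x Bx; apply: sC; exists 1 => //; exists x; rewrite ?mul1r.
Qed.

Lemma creal_mulDl : left_distributive creal_mul creal_add.
Proof.
move=> a b c; apply/esym/filter_of_inj.
apply: (filter_of_minimal (creal_mul (creal_add a b) c)).2 => //.
move=> D [E [E' [[A [C [aA cC sE]]] [B [C' [bB cC' sE']]] sD]]].
(* Intersecting [C] and [C'] lets one [z] serve both products; minimality of [(a + b) * c] dispenses
   with the converse inclusion. *)
exists [set x + y | x in A & y in B], (C `&` C').
split; [by exists A, B; split|exact: filterI|].
move=> _ [_ [x Ax [y By <-]] [z [Cz C'z] <-]]; rewrite mulrDl; apply: sD.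
exists (x * z); first by apply: sE; exists x => //; exists z.
exists (y * z) => //.
by apply: sE'; exists y => //; exists z.
Qed.

(** Otherwise a proper filter would contain the disjoint balls of radius [1 / 2] about 0 and 1. *)
Lemma creal_1_neq0 : creal_rat 1 != creal_rat 0.
Proof.
apply/eqP => /(congr1 filter_of) E10.
have P1 := filter_of_proper (creal_rat 1).
have h0 : 0 < 1 / 2 :> rat by lra.
have B1 : filter_of (creal_rat 1) [set x | `|x - 1| < 1 / 2].
  exact: rat_filter_ball.
have B0 : filter_of (creal_rat 1) [set x | `|x - 0| < 1 / 2].
  by rewrite E10; exact: rat_filter_ball.
by have [x [/= x1 x0]] := filter_ex (filterI B1 B0); clear E10; norm_lra.
Qed.

Lemma creal_inv0 : creal_inv (creal_rat 0) = creal_rat 0.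
Proof. by rewrite /creal_inv; case: pselect. Qed.

Lemma creal_mulV a : a != creal_rat 0 -> creal_mul (creal_inv a) a = creal_rat 1.
Proof.
move=> /eqP a0; rewrite /creal_inv; case: pselect => // a0'; apply: filter_of_inj.
have PH : ProperFilter (filter_mul (GRing.inv @ filter_of a) (filter_of a)).
  exact: filter_lift2_proper.
apply: (minimal_cauchy_filter_eq PH) => //.
  by apply: filter_lift2_mono => //; exact: roundification_sub.
apply: rat_filter_subP => e e0.
have [|d d0 ad] := minimal_cauchy_filter_away0 (filter_of_minimal a).
  by move=> /(@filter_of_inj a (creal_rat 0)).
(* For [y] and [x^-1] in [A], [x * y - 1] equals [(y - x^-1) / x^-1], and the divisor has absolute
   value at least [d]. *)
have ed0 : 0 < e * d by exact: mulr_gt0.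
have [A aA sA] := (cauchy_filterP (filter_of_proper a)).1 (filter_of_cauchy a) _ ed0.
exists [set x | A x^-1 /\ d <= `|x^-1|], A; split=> //.
  by rewrite /fmap /=; apply: filterS (filterI aA ad) => x Ax /=; rewrite invrK.
move=> _ [x [Ax dx] [y Ay <-]] /=.
have x_gt0 : 0 < `|x^-1| by exact: lt_le_trans dx.
have x0 : x != 0 by rewrite -invr_eq0 -normr_gt0.
rewrite -(ltr_pM2r x_gt0) -normrM.
have -> : (x * y - 1) * x^-1 = y - x^-1 by field.
by apply: (lt_le_trans (sA _ _ Ay Ax)); rewrite ler_pM2l.
Qed.

(** * The field structure *)

HB.instance Definition _ := GRing.isZmodule.Build cauchy_real
  creal_addA creal_addC creal_add0 creal_addN.
HB.instance Definition _ := GRing.Zmodule_isComNzRing.Build cauchy_real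
  creal_mulA creal_mulC creal_mul1 creal_mulDl creal_1_neq0.
HB.instance Definition _ := GRing.ComNzRing_isField.Build cauchy_real
  creal_mulV creal_inv0.

(* [c] is a library field structure on the carrier [cauchy_real] itself, whose
   addition and multiplication are the given operations on filters. *)
Theorem theorem4p25 :
  exists c : GRing.Field cauchy_real,
    let K : fieldType := GRing.Field.Pack c in
    (forall a b : K, filter_of (a + b) = filter_add (filter_of a) (filter_of b)) /\
    (forall a b : K, filter_of (a * b) = filter_mul (filter_of a) (filter_of b)).
Proof. by exists (GRing.Field.class cauchy_real). Qed.
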